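(* Every nonempty saturated subset of $\mathbb{SN}$ is one of the following sets: 1) $\{1,2,\ldots,n\}$ for some $n\in\mathbb{N}$, or $\mathbb{N}$; 2) $S(\infty,s)$ for some $s\in\mathbb{SN}\setminus\mathbb{N}$; 3) $S(r,s)$ for some $s\in\mathbb{SN}\setminus\mathbb{N}$ and some real $r\in[1,\infty)$; 4) $S^{+}(r,s)$ for some $s\in\mathbb{SN}\setminus\mathbb{N}$ and $r=u/v$ with $u\in\mathbb{N}$, $v\in\Omega(s)$.
   Context: A Steinitz number is a formal product $\prod_{p} p^{r_p}$ over all primes $p$, with $r_p\in\mathbb{N}\cup\{0,\infty\}$; $\mathbb{SN}$ is the set of all of them, and $\mathbb{N}=\{1,2,\ldots\}\subset\mathbb{SN}$; elements of $\mathbb{SN}\setminus\mathbb{N}$ are called infinite. Multiplication adds exponents ($\infty$ absorbing), divisibility is exponentwise $\le$. For $s\in\mathbb{SN}$, $\Omega(s)$ is the set of $n\in\mathbb{N}$ dividing $s$. For $b\in\Omega(s)$, $s/b$ is obtained by subtracting exponents (with $\infty-k=\infty$), and for $a\in\mathbb{N}$, $\frac{a}{b}s:=a\cdot(s/b)$. Write $s_1|_{fin}\,s_2$ if $s_1=s_2/b$ for some $b\in\Omega(s_2)$. Steinitz numbers $s_1,s_2$ are rationally connected if $s_2=q\cdot s_1$ for some rational $q$, i.e. $s_2=\frac{a}{b}s_1$ for some $a\in\mathbb{N}$, $b\in\Omega(s_1)$. A subset $S\subset\mathbb{SN}$ is saturated if: 1) any two elements of $S$ are rationally connected; 2) if $s_2\in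 S$ and $s_1|_{fin}\,s_2$ then $s_1\in S$; 3) if $s, ns\in S$ with $n\in\mathbb{N}$, then $is\in S$ for all $1\le i\le n$. Define $S(\infty,s)=\{\frac{a}{b}s\mid a\in\mathbb{N},\ b\in\Omega(s)\}$; $S(r,s)=\{\frac{a}{b}s\mid a\in\mathbb{N},\ b\in\Omega(s),\ a\le rb\}$; $S^{+}(r,s)=\{\frac{a}{b}s\mid a\in\mathbb{N},\ b\in\Omega(s),\ a<rb\}$. *)

(* Defs.v *)
From mathcomp Require Import all_boot all_order all_algebra.
From mathcomp Require Import classical_sets reals.
Import Order.TTheory GRing.Theory Num.Theory.

Set Implicit Arguments.
Unset Strict Implicit.
Unset Printing Implicit Defensive.

Local Open Scope classical_set_scope.
Local Open Scope nat_scope.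

(* Exponents in {0, 1, 2, ...} extended with oo; [None] stands for oo. *)
Definition exponent := option nat.

Definition expo_add (x y : exponent) : exponent :=
  match x, y with
  | Some m, Some n => Some (m + n)
  | _, _ => None
  end.

Definition expo_le (x y : exponent) : bool :=
  match x, y with
  | _, None => true
  | None, Some _ => false
  | Some m, Some n => m <= n
  end.

(* [oo - k = oo]; on finite exponents the subtraction is truncated, and is only
   used below when [k <= x]. *)
Definition expo_subn (x : exponent) (k : nat) : exponent :=
  if x is Some m then Some (m - k) else None.

Definition prime_number := {p : nat | prime p}.

(* A formal product of p ^ r_p is represented by the family of its exponents. *)
Definition steinitz := prime_number -> exponent.

(* The embedding of the positive integers; its value at 0 is irrelevant, and
   every use below comes with a positivity condition. *)
Definition steinitz_of_nat (n : nat) : steinitz :=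
  fun p => Some (logn (val p) n).

Definition steinitz_mul (s t : steinitz) : steinitz :=
  fun p => expo_add (s p) (t p).

Definition steinitz_dvd (s t : steinitz) : Prop :=
  forall p, expo_le (s p) (t p).

Definition steinitz_nat : set steinitz :=
  [set s | exists2 n : nat, 0 < n & s = steinitz_of_nat n].

Definition steinitz_infinite : set steinitz := ~` steinitz_nat.

Definition Omega (s : steinitz) : set nat :=
  [set n | 0 < n /\ steinitz_dvd (steinitz_of_nat n) s].

(* s / b, meaningful for b in Omega s. *)
Definition steinitz_divn (s : steinitz) (b : nat) : steinitz :=
  fun p => expo_subn (s p) (logn (val p) b).

Definition steinitz_muln (n : nat) (s : steinitz) : steinitz :=
  steinitz_mul (steinitz_of_nat n) s.

(* (a / b) s, meaningful for 0 < a and b in Omega s; it depends on the pair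
   (a, b), the representation of an element in this form need not be unique. *)
Definition steinitz_frac (a b : nat) (s : steinitz) : steinitz :=
  steinitz_muln a (steinitz_divn s b).

Definition fin_dvd (s1 s2 : steinitz) : Prop :=
  exists2 b : nat, Omega s2 b & s1 = steinitz_divn s2 b.

Definition rationally_connected (s1 s2 : steinitz) : Prop :=
  exists a b : nat, [/\ 0 < a, Omega s1 b & s2 = steinitz_frac a b s1].

Definition saturated (S : set steinitz) : Prop :=
  [/\ forall s1 s2, S s1 -> S s2 -> rationally_connected s1 s2,
      forall s1 s2, S s2 -> fin_dvd s1 s2 -> S s1
    & forall (s : steinitz) (n : nat), 0 < n -> S s -> S (steinitz_muln n s) ->
        forall i : nat, 1 <= i <= n -> S (steinitz_muln i s)].

Definition S_infty (s : steinitz) : set steinitz :=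
  [set t | exists a b : nat, [/\ 0 < a, Omega s b & t = steinitz_frac a b s]].

Definition S_le (R : realType) (r : R) (s : steinitz) : set steinitz :=
  [set t | exists a b : nat, [/\ 0 < a, Omega s b,
     (a%:R <= r * b%:R)%R & t = steinitz_frac a b s]].

Definition S_lt (R : realType) (r : R) (s : steinitz) : set steinitz :=
  [set t | exists a b : nat, [/\ 0 < a, Omega s b,
     (a%:R < r * b%:R)%R & t = steinitz_frac a b s]].

Definition nat_segment (n : nat) : set steinitz :=
  [set s | exists2 i : nat, 1 <= i <= n & s = steinitz_of_nat i].

(* Main.v *)
(** Fix [s] in [S]. Every element of [S] is [(a / b) s] for some fraction [a / b]
    with [b] in [Omega s]. Writing two fractions over a common denominator [L]
    and applying the third saturation condition to [s / L], membership of
    [(a / b) s] in [S] is downward closed in the value [a / b]. Hence [S] is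
    cut out by a threshold: [oo] if all fractions occur, and otherwise the
    supremum [r] of the fractions which occur; the strict version is needed
    exactly when [r] is itself a fraction that does not occur. *)

Require Import Defs.
From mathcomp Require Import all_boot all_order all_algebra zify.
From mathcomp Require Import boolp classical_sets reals.
Import Order.TTheory GRing.Theory Num.Theory.

Set Implicit Arguments.
Unset Strict Implicit.
Unset Printing Implicit Defensive.

Lemma Omega1 (s : steinitz) : Omega s 1.
Proof. by split=> // p; rewrite /steinitz_of_nat logn1; case: (s p). Qed.

Lemma Omega_lcm (s : steinitz) (m n : nat) :
  Omega s m -> Omega s n -> Omega s (lcmn m n).
Proof.
move=> [m0 ms] [n0 ns]; split; first by rewrite lcmn_gt0 m0.
move=> p; have := ms p; have := ns p; rewrite /steinitz_of_nat.
by case: (s p) => //= k nk mk; rewrite logn_lcm // geq_max mk.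
Qed.

Lemma frac1 (s : steinitz) (a : nat) : steinitz_frac a 1 s = steinitz_muln a s.
Proof.
apply: funext => p; rewrite /steinitz_frac /steinitz_divn /steinitz_muln.
by rewrite /steinitz_mul logn1; case: (s p) => //= k; rewrite subn0.
Qed.

Lemma muln1_id (s : steinitz) : steinitz_muln 1 s = s.
Proof.
apply: funext => p; rewrite /steinitz_muln /steinitz_mul /steinitz_of_nat.
by rewrite logn1; case: (s p).
Qed.

(** As [b * k] divides [s], no finite exponent is truncated in the subtraction, so the two
    contributions of [k] cancel. *)
Lemma frac_mul2r (s : steinitz) (a b k : nat) : 0 < a -> Omega s (b * k) ->
  steinitz_frac (a * k) (b * k) s = steinitz_frac a b s.
Proof.
move=> a0 [bk0 bks]; have /andP[b0 k0] : (0 < b) && (0 < k) by rewrite -muln_gt0.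
apply: funext => p; have := bks p.
rewrite /steinitz_frac /steinitz_divn /steinitz_muln /steinitz_mul.
rewrite /steinitz_of_nat !lognM //.
by case: (s p) => //= m h; congr Some; lia.
Qed.

Lemma muln_of_nat1 (n : nat) :
  steinitz_muln n (steinitz_of_nat 1) = steinitz_of_nat n.
Proof.
apply: funext => p; rewrite /steinitz_muln /steinitz_mul /steinitz_of_nat /=.
by rewrite logn1 addn0.
Qed.

(** All exponents of 1 are 0, and truncated subtraction keeps them at 0, so [b] leaves no trace. *)
Lemma frac_of_nat1 (a b : nat) :
  steinitz_frac a b (steinitz_of_nat 1) = steinitz_of_nat a.
Proof.
apply: funext => p; rewrite /steinitz_frac /steinitz_divn /steinitz_muln.
by rewrite /steinitz_mul /steinitz_of_nat logn1 /= sub0n addn0.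
Qed.

Lemma fin_dvd_of_nat1 (n : nat) : 0 < n ->
  fin_dvd (steinitz_of_nat 1) (steinitz_of_nat n).
Proof.
move=> n0; exists n; first by split=> // p /=.
apply: funext => p; rewrite /steinitz_divn /steinitz_of_nat /=.
by rewrite logn1 subnn.
Qed.

Lemma saturated_frac_mono (S : set steinitz) (s : steinitz) (a b c d : nat) :
  saturated S -> 0 < a -> Omega s b -> 0 < c -> Omega s d ->
  c * b <= a * d -> S (steinitz_frac a b s) -> S (steinitz_frac c d s).
Proof.
move=> [_ Sdvd Smul] a0 Ob c0 Od cbad Sab.
have OL := Omega_lcm Ob Od; have [[[b0 _] [d0 _]] [L0 _]] := (Ob, Od, OL).
have /dvdnP[k Lk] := dvdn_lcml b d; have /dvdnP[l Ll] := dvdn_lcmr b d.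
have [k0 l0] : 0 < k /\ 0 < l by split; lia.
have Ea : steinitz_frac a b s =
    steinitz_muln (a * k) (steinitz_divn s (lcmn b d)).
  by rewrite -(@frac_mul2r s a b k) // (mulnC b) -Lk.
have Ec : steinitz_frac c d s =
    steinitz_muln (c * l) (steinitz_divn s (lcmn b d)).
  by rewrite -(@frac_mul2r s c d l) // (mulnC d) -Ll.
have ak0 : 0 < a * k by rewrite muln_gt0 a0.
(* With L the lcm, (a / b) s is [a * k] times s / L; dividing by [a * k] is a finite division, so
   the second condition gives s / L. *)
have SL : S (steinitz_divn s (lcmn b d)).
  apply: (Sdvd _ (steinitz_frac a b s)) => //.
  exists (a * k).
    split=> // p; rewrite Ea /steinitz_muln /steinitz_mul /=.
    by case: (steinitz_divn s _ p) => //= m; exact: leq_addr.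
  rewrite Ea; apply: funext => p.
  rewrite [RHS]/steinitz_divn /steinitz_muln /steinitz_mul /=.
  by case: (steinitz_divn s _ p) => //= m; rewrite addKn.
rewrite Ec; apply: (Smul _ (a * k)) => //; first by rewrite -Ea.
(* The bound c l <= a k is checked after multiplication by [b], where k b = L = l d turns it into
   [cbad] times [l]. *)
rewrite muln_gt0 c0 l0 /= -(leq_pmul2r (n1 := c * l) b0).
have -> : a * k * b = a * d * l by rewrite -mulnA -Lk Ll mulnA mulnAC.
by rewrite mulnAC leq_mul2r cbad orbT.
Qed.

(** Dividing n by itself puts 1 in [S]. Rational connection to 1 makes all elements natural, and the
    third condition at 1 makes [S] downward closed, so the least missing integer decides. *)
Lemma saturated_nat (S : set steinitz) (n : nat) : saturated S -> 0 < n ->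
  S (steinitz_of_nat n) ->
  (exists2 n : nat, 0 < n & S = nat_segment n) \/ S = steinitz_nat.
Proof.
move=> [Scon Sdvd Smul] n0 Sn.
have S1 : S (steinitz_of_nat 1) := Sdvd _ _ Sn (fin_dvd_of_nat1 n0).
have Snat t : S t -> exists2 a, 0 < a & t = steinitz_of_nat a.
  by move=> /(Scon _ _ S1)[a [b [a0 _ ->]]]; exists a; rewrite ?frac_of_nat1.
have Sdown m i : 0 < m -> S (steinitz_of_nat m) -> 1 <= i <= m ->
    S (steinitz_of_nat i).
  by move=> m0; rewrite -(muln_of_nat1 m) -(muln_of_nat1 i) => Sm; exact: (Smul _ m).
have [Sall|/existsNP[m /not_implyP[m0 Sm]]] :=
    pselect (forall m, 0 < m -> S (steinitz_of_nat m)).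
  right; apply/seteqP; split=> [t /Snat//|t [a a0 ->]]; exact: Sall.
left; have ex : exists m, (0 < m) && `[< ~ S (steinitz_of_nat m) >].
  by exists m; rewrite m0; apply/asboolP.
(* The least missing integer is neither 0 nor 1, hence of the form [m.+2], and the segment ends at
   [m.+1]. *)
case: (ex_minnP ex) => {m m0 Sm}-[//|[|m]] /andP[_ /asboolP Sm] mmin.
  by case: Sm.
exists m.+1 => //; apply/seteqP; split=> [t St|t [i /andP[i0 im] ->]].
  have [a a0 ta] := Snat _ St; exists a => //; rewrite a0 leqNgt; apply/negP.
  by move=> ma; apply: Sm; apply: (Sdown a) => //; rewrite -ta.
apply: contrapT => Si.
have := mmin i; rewrite i0 => /(_ (asboolT Si)); lia.
Qed.

Section Fractions.
Variable R : realType.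
Local Open Scope ring_scope.

Lemma ltr_frac_nat (a b c d : nat) : (0 < b)%N -> (0 < d)%N ->
  (a%:R / b%:R < c%:R / d%:R :> R) = (a * d < c * b)%N.
Proof.
by move=> b0 d0; rewrite ltr_pdivrMr ?ltr0n // mulrAC ltr_pdivlMr ?ltr0n //
  -!natrM ltr_nat.
Qed.

Definition saturated_fractions (S : set steinitz) (s : steinitz) : set R :=
  [set x | exists a b : nat, [/\ (0 < a)%N, Omega s b,
     S (steinitz_frac a b s) & x = a%:R / b%:R]]%classic.

Lemma saturated_threshold (S : set steinitz) (s : steinitz) :
  saturated S -> S s -> steinitz_infinite s ->
  S = S_infty s \/
  (exists r : R, 1 <= r /\ S = S_le r s) \/
  (exists u v : nat, [/\ (0 < u)%N, Omega s v & S = S_lt (u%:R / v%:R : R) s]).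
Proof.
move=> Ssat Ss s_inf; have [Scon _ _] := Ssat.
have Sfrac t : S t ->
    exists a b, [/\ (0 < a)%N, Omega s b & t = steinitz_frac a b s].
  exact: Scon.
have [Sall|] := pselect (forall a b, (0 < a)%N -> Omega s b ->
    S (steinitz_frac a b s)).
  left; apply/seteqP; split=> [t /Sfrac//|t [a [b [a0 Ob ->]]]]; exact: Sall.
move=> /existsNP[a1 /existsNP[b1 /not_implyP[a10 /not_implyP[Ob1 NS1]]]].
right; set X := saturated_fractions S s.
have XP a b : (0 < a)%N -> Omega s b -> S (steinitz_frac a b s) ->
    X (a%:R / b%:R) by move=> *; exists a, b.
(* By monotonicity a missing fraction strictly exceeds every occurring one. This bounds [X], and
   later yields the strict inequality of [S_lt]. *)
have Xlt u v : (0 < u)%N -> Omega s v -> ~ S (steinitz_frac u v s) ->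
    forall x, X x -> x < u%:R / v%:R.
  move=> u0 Ov NS _ [a [b [a0 Ob Sab ->]]].
  have [[b0 _] [v0 _]] := (Ob, Ov); rewrite ltr_frac_nat // ltnNge.
  by apply/negP => h; apply: NS; exact: saturated_frac_mono Sab.
(* The value 1 comes from [s] itself; it makes [X] nonempty and forces the threshold to be at least
   1. *)
have X1 : X 1.
  exists 1%N, 1%N; split; rewrite ?divr1 //; first exact: Omega1.
  by rewrite frac1 muln1_id.
have Xsup : has_sup X.
  by split; [exists 1 | exists (a1%:R / b1%:R) => x /(Xlt _ _ a10 Ob1 NS1)/ltW].
have Xle x : X x -> x <= sup X by exact: sup_upper_bound.
(* Below the supremum, some occurring fraction is larger, and monotonicity descends from it. *)
have Xdown a b : (0 < a)%N -> Omega s b -> a%:R / b%:R < sup X ->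
    S (steinitz_frac a b s).
  move=> a0 Ob /(sup_gt _)[]; first by exists 1.
  move=> _ [c [d [c0 Od Scd ->]]]; have [[b0 _] [d0 _]] := (Ob, Od).
  by rewrite ltr_frac_nat // => /ltnW h; exact: saturated_frac_mono Scd.
have [[u [v [u0 Ov NS uv]]]|Natt] := pselect (exists u v, [/\ (0 < u)%N,
    Omega s v, ~ S (steinitz_frac u v s) & sup X = u%:R / v%:R]).
  right; exists u, v; split=> //; apply/seteqP; split=> t.
    move=> St; have [a [b [a0 Ob tab]]] := Sfrac _ St; have [b0 _] := Ob.
    exists a, b; split=> //; rewrite -ltr_pdivrMr ?ltr0n //.
    by apply: Xlt => //; apply: XP; rewrite -?tab.
  move=> [a [b [a0 Ob ab ->]]]; have [b0 _] := Ob.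
  by apply: Xdown => //; rewrite uv ltr_pdivrMr ?ltr0n.
left; exists (sup X); split; first exact: Xle.
apply/seteqP; split=> t.
  move=> St; have [a [b [a0 Ob tab]]] := Sfrac _ St; have [b0 _] := Ob.
  exists a, b; split=> //; rewrite -ler_pdivrMr ?ltr0n //.
  by apply: Xle; apply: XP; rewrite -?tab.
move=> [a [b [a0 Ob + ->]]]; have [b0 _] := Ob.
rewrite -ler_pdivrMr ?ltr0n // le_eqVlt => /orP[/eqP ab|]; last exact: Xdown.
(* A missing fraction equal to the supremum would fall under the strict case, already excluded by
   [Natt]. *)
by apply: contrapT => NS; apply: Natt; exists a, b.
Qed.

End Fractions.

Theorem theorem2 (R : realType) (S : set steinitz)
    (S_neq0 : (S !=set0)%classic) (S_sat : saturated S) :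
  ((exists2 n : nat, (0 < n)%N & S = nat_segment n) \/ S = steinitz_nat) \/
  (exists2 s : steinitz, steinitz_infinite s & S = S_infty s) \/
  (exists (s : steinitz) (r : R),
     [/\ steinitz_infinite s, (1 <= r)%R & S = S_le r s]) \/
  (exists (s : steinitz) (u v : nat),
     [/\ steinitz_infinite s, (0 < u)%N, Omega s v
       & S = S_lt (u%:R / v%:R : R)%R s]).
Proof.
have [s Ss] := S_neq0.
(* Any element serves as base point: whether it is natural or infinite selects the family. *)
have [[n n0 sn]|s_inf] := pselect (steinitz_nat s).
  by left; apply: (saturated_nat S_sat n0); rewrite -sn.
right; have [?|[[r [r1 ?]]|[u [v [u0 Ov ?]]]]] :=
    saturated_threshold R S_sat Ss s_inf.
- by left; exists s.
- by right; left; exists s, r.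
- by right; right; exists s, u, v.
Qed.
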